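(* Let $N\in\mathbb{Z}_+$, let $X\subseteq\mathbb{R}^n$ be open, and let $G\colon X\times U\to X$ be such that for every $w\in U$ the map $G(\cdot,w)$ is a $C^1$-diffeomorphism onto an open subset of $X$. Let $\psi$ be the general solution of $x_{k+1}=G(x_k,u_k)$. Assume that $U$ is finite; that $C$ is a finite covering of $\mathbb{R}^n$ whose elements are nonempty convex polyhedra; and that $C'\subseteq C$ is such that to each $\Delta\in C'$ there is assigned a superset $\widehat\Delta\supseteq\Delta$ with $\widehat\Delta\subseteq X$ for which $\psi(k,\widehat\Delta,u)$ is convex for all $k\in[1;N]$ and all $u\colon[0;k[\,\to U$. Let $\Delta\colon[0;N]\to C'$, $u\colon[0;N[\,\to U$, and $\Sigma,S\colon[0;N]\to\mathcal{P}(\mathbb{R}^n\times\mathbb{R}^n)$. Assume that $\Sigma_k$ is a supporting convex approximation of $\widehat\Delta_k$ for all $k\in[0;N]$, and $$S_0=\Sigma_0,\qquad S_k=\Sigma_k\cup G(\cdot,u_{k-1})^{\lozenge}(S_{k-1})\quad\text{for } k\in[1;N].$$ Then, for all $k\in[1;N]$, $G(\cdot,u_{k-1})^{\lozenge}(S_{k-1})$ is an outer convex approximation of $$\bigcap_{\tau=1}^k\psi(\tau,\widehat\Delta_{k-\tau},u|_{[k-\tau;k[}),$$ and in particular, $S_k$ is an outer convex approximation of $$\widehat\Delta_k\cap\bigcap_{\tau=1}^k\psi(\tau,\widehat\Delta_{k-\tau},u|_{[k-\tau;k[}).$$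
   Context: Notation: $\mathbb{Z}_+=\{0,1,2,\dots\}$; $[a;b]$, $[a;b[$ denote the sets of integers $j$ with $a\le j\le b$, resp. $a\le j<b$. $\mathcal{P}(\cdot)$ is the power set; $A^*$ is the transpose of $A$; $\langle\cdot,\cdot\rangle$ is the standard inner product. A convex polyhedron is a finite intersection of closed half-spaces. General solution: $\psi(0,x_0,u)=x_0$, $\psi(k+1,x_0,u)=G(\psi(k,x_0,u),u_k)$; only the first $k$ input values matter for $\psi(k,x_0,u)$, and $\psi(\tau,\cdot,u|_{[k-\tau;k[})$ means that the $\tau$ inputs $u_{k-\tau},\dots,u_{k-1}$ are applied successively. Set arguments are understood pointwise: $\psi(k,\Omega,u)=\{\psi(k,x,u): x\in\Omega\}$. $P(p,v)=\{x\in\mathbb{R}^n:\langle v,x-p\rangle\le 0\}$ for $p,v\in\mathbb{R}^n$, and $P(\Sigma)=\bigcap_{(p,v)\in\Sigma}P(p,v)$ for $\Sigma\subseteq\mathbb{R}^n\times\mathbb{R}^n$. A vector $v$ is normal to $\Omega\subseteq\mathbb{R}^n$ at a boundary point $p$ of $\Omega$ if $\langle v,x-p\rangle\le0$ for all $x\in\Omega$. $\Sigma\subseteq\mathbb{R}^n\times\mathbb{R}^n$ is an outer convex approximation of $\Omega$ if $\Omega\subseteq P(\Sigma)$, and a supporting convex approximation of $\Omega$ if $p\in\Omega$ and $v$ is normal to $\Omega$ at $p$ for all $(p,v)\in\Sigma$. Complementary extension: for a $C^1$-diffeomorphism $\Phi\colon V\to W$ between open subsets of $\mathbb{R}^n$,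 $\Phi^{\lozenge}\colon V\times\mathbb{R}^n\to W\times\mathbb{R}^n$, $\Phi^{\lozenge}(p,v)=(\Phi(p),(\Phi'(p)^{-1})^*v)$. $G(\cdot,w)^\lozenge$ is the complementary extension of $G(\cdot,w)$; images of sets are taken pointwise. *)

(* Defs.v *)
From HB Require Import structures.
From mathcomp Require Import all_boot all_order all_algebra.
From mathcomp Require Import all_classical all_reals all_analysis.
Set Implicit Arguments.
Unset Strict Implicit.
Unset Printing Implicit Defensive.
Import Order.TTheory GRing.Theory Num.Theory.
Import numFieldNormedType.Exports.
Local Open Scope classical_set_scope.
Local Open Scope ring_scope.

(* Points of R^n are row vectors; matrices act on them from the right. *)

Definition inner (R : realType) (n : nat) (v x : 'rV[R]_n) : R :=
  \sum_(i < n) v 0 i * x 0 i.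

Definition halfspace (R : realType) (n : nat) (p v : 'rV[R]_n) :
    set 'rV[R]_n :=
  [set x | inner v (x - p) <= 0].

Definition polyset (R : realType) (n : nat)
    (Sigma : set ('rV[R]_n * 'rV[R]_n)) : set 'rV[R]_n :=
  \bigcap_(pv in Sigma) halfspace pv.1 pv.2.

(* halfspace p 0 is the whole space, hence the condition v != 0. *)
Definition closed_halfspace (R : realType) (n : nat) (H : set 'rV[R]_n) : Prop :=
  exists p v : 'rV[R]_n, v != 0 /\ H = halfspace p v.

Definition convex_polyhedron (R : realType) (n : nat) (D : set 'rV[R]_n) :
    Prop :=
  exists F : set (set 'rV[R]_n),
    [/\ finite_set F, F `<=` @closed_halfspace R n & D = \bigcap_(H in F) H].

Definition boundary (T : topologicalType) (A : set T) : set T :=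
  closure A `\` interior A.

Definition normal_at (R : realType) (n : nat) (Omega : set 'rV[R]_n)
    (p v : 'rV[R]_n) : Prop :=
  boundary Omega p /\ forall x, Omega x -> inner v (x - p) <= 0.

Definition outer_convex_approx (R : realType) (n : nat)
    (Omega : set 'rV[R]_n) (Sigma : set ('rV[R]_n * 'rV[R]_n)) : Prop :=
  Omega `<=` polyset Sigma.

Definition supporting_convex_approx (R : realType) (n : nat)
    (Omega : set 'rV[R]_n) (Sigma : set ('rV[R]_n * 'rV[R]_n)) : Prop :=
  forall p v, Sigma (p, v) -> Omega p /\ normal_at Omega p v.

(* Maps between open sets are total functions of which only the restriction to
   the domain matters; on an open set the derivative depends on it only. *)
Definition C1_on (R : realType) (n : nat) (V : set 'rV[R]_n)
    (f : 'rV[R]_n -> 'rV[R]_n) : Prop :=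
  forall x, V x ->
    differentiable f x /\ {for x, continuous (fun y => jacobian f y)}.

Definition C1_diffeo (R : realType) (n : nat) (V W : set 'rV[R]_n)
    (f : 'rV[R]_n -> 'rV[R]_n) : Prop :=
  [/\ open V, open W, set_bij V W f, C1_on V f &
      exists g : 'rV[R]_n -> 'rV[R]_n,
        {in V, cancel f g} /\ C1_on W g].

(* With row vectors, Phi'(p) h = h *m J for J := jacobian Phi p, so the adjoint
   of Phi'(p)^-1 maps v to v *m (J^-1)^T. *)
Definition compl_ext (R : realType) (n : nat) (Phi : 'rV[R]_n -> 'rV[R]_n)
    (pv : 'rV[R]_n * 'rV[R]_n) : 'rV[R]_n * 'rV[R]_n :=
  (Phi pv.1, pv.2 *m (invmx (jacobian Phi pv.1))^T).

(* Input signals are total; only u 0, ..., u (k - 1) matter for psi G k x u. *)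
Fixpoint psi (V U : Type) (G : V -> U -> V) (k : nat) (x : V) (u : nat -> U) :
    V :=
  if k is j.+1 then G (psi G j x u) (u j) else x.

Definition shift_input (U : Type) (m : nat) (u : nat -> U) : nat -> U :=
  fun j => u (m + j)%N.

(* The intersection over tau in [1;k] of the sets
   psi (tau, Omega_(k-tau), u restricted to [k-tau;k[). *)
Definition reach_cap (R : realType) (n : nat) (U : Type)
    (G : 'rV[R]_n -> U -> 'rV[R]_n) (Omega : nat -> set 'rV[R]_n)
    (u : nat -> U) (k : nat) : set 'rV[R]_n :=
  \bigcap_(tau in [set tau : nat | (1 <= tau <= k)%N])
    [set psi G tau x (shift_input (k - tau) u) | x in Omega (k - tau)%N].

(* Main.v *)
Require Import Defs.
From HB Require Import structures.
From mathcomp Require Import all_boot all_order all_algebra.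
From mathcomp Require Import all_classical all_reals all_analysis.
Set Implicit Arguments.
Unset Strict Implicit.
Unset Printing Implicit Defensive.
Import Order.TTheory GRing.Theory Num.Theory.
Import numFieldNormedType.Exports.
Local Open Scope classical_set_scope.
Local Open Scope ring_scope.

(** Let (q, w) be the image of a supporting pair (p, v) of a set Omega under
    the complementary extension of a diffeomorphism f.  If f(Omega) is convex,
    then f(Omega) lies in P(q, w), q = f(p): for x in Omega the segment from
    f(p) to f(x) stays in f(Omega), so its preimage under f is a curve in Omega
    that starts at p and stays in the half-space P(p, v); hence its initial
    velocity f'(p)^-1 (f(x) - f(p)) has a nonpositive inner product with v.
    Moving the inverse derivative to the other side of the inner product gives
    <w, f(x) - q> <= 0.  This is [transports_halfspace].

    Unfolding the recursion, every pair of S_k is the image of a pair of some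
    Sigma_(k - tau) under tau successive complementary extensions
    ([S_transported]).  By the chain rule this is the complementary extension
    of the tau-step flow ([transports_comp]), and the tau-step image of
    hat Delta_(k - tau) is convex for tau >= 1, so the half-space of the pair
    contains that image, which is one of the sets being intersected. *)

Lemma inner_mulmx (R : realType) (n : nat) (v x : 'rV[R]_n) :
  inner v x = (v *m x^T) 0 0.
Proof. by rewrite mxE; apply: eq_bigr => i _; rewrite mxE. Qed.

Lemma innerZr (R : realType) (n : nat) (v x : 'rV[R]_n) (a : R) :
  inner v (a *: x) = a * inner v x.
Proof. by rewrite !inner_mulmx linearZ -scalemxAr mxE. Qed.

Lemma inner_trmx (R : realType) (n : nat) (v x : 'rV[R]_n) (A : 'M[R]_n) :
  inner (v *m A^T) x = inner v (x *m A).
Proof. by rewrite !inner_mulmx trmx_mul mulmxA. Qed.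

Lemma continuous_inner (R : realType) (n : nat) (v : 'rV[R]_n) :
  continuous (inner v).
Proof.
apply: continuous_big => [|i _ x]; first exact: add_continuous.
exact: (cvgM (cvg_cst (v 0 i)) (@coord_continuous R 1 n 0 i x)).
Qed.

(** A left inverse on an open neighbourhood satisfies g o f = id near x, so the
    chain rule makes the two Jacobians inverse to each other. *)
Lemma jacobian_left_inverse (R : realType) (n : nat) (X : set 'rV[R]_n)
    (f g : 'rV[R]_n -> 'rV[R]_n) (x : 'rV[R]_n) :
  open X -> X x -> {in X, cancel f g} ->
  differentiable f x -> differentiable g (f x) ->
  invmx (jacobian f x) = jacobian g (f x).
Proof.
move=> oX Xx fK df dg.
have fgid : \near x, (g \o f) x = id x.
  near=> y; apply: fK; rewrite inE; near: y.
  exact: (open_nbhs_nbhs (conj oX Xx)).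
have fgE : jacobian f x *m jacobian g (f x) = 1%:M.
  apply/row_matrixP => i; rewrite !rowE mulmx1 mulmxA !mul_rV_lin1.
  have := diff_comp df dg => /(congr1 (fun h => h (delta_mx 0 i))) /= <-.
  rewrite -deriveE; last exact: differentiable_comp.
  by rewrite (near_eq_derive _ fgid) derive_id.
have [fu _] := mulmx1_unit fgE.
by rewrite -[RHS]mul1mx -(mulVmx fu) -mulmxA fgE mulmx1.
Unshelve. all: by end_near.
Qed.

(** The relation that pv is mapped to qw by the complementary extension of f,
    expressed through the derivative of a left inverse g of f instead of the
    inverse of the Jacobian of f: <w, h> = <v, g'(q) h> says that w is the image
    of v under the adjoint of g'(q) = f'(p)^-1.  In this form the relation
    composes by the chain rule for g alone, and g is also what pulls segments
    back to the domain. *)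
Definition transports (R : realType) (n : nat) (X : set 'rV[R]_n)
    (f : 'rV[R]_n -> 'rV[R]_n) (pv qw : 'rV[R]_n * 'rV[R]_n) : Prop :=
  qw.1 = f pv.1 /\
  exists g : 'rV[R]_n -> 'rV[R]_n,
    [/\ {in X, cancel f g}, differentiable g (f pv.1) &
        forall h, inner qw.2 h = inner pv.2 ('d g (f pv.1) h)].

Lemma transports_id (R : realType) (n : nat) (X : set 'rV[R]_n)
    (pv : 'rV[R]_n * 'rV[R]_n) : transports X id pv pv.
Proof.
split=> //; exists id; split=> // h.
by rewrite -deriveE ?derive_id.
Qed.

Lemma transports_compl_ext (R : realType) (n : nat) (X W : set 'rV[R]_n)
    (f : 'rV[R]_n -> 'rV[R]_n) (pv : 'rV[R]_n * 'rV[R]_n) :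
  C1_diffeo X W f -> X pv.1 -> transports X f pv (compl_ext f pv).
Proof.
case=> oX oW [fXW _ _] fC1 [g [fK gC1]] Xp.
have [df _] := fC1 _ Xp.
have [dg _] := gC1 _ (fXW _ Xp).
split=> //; exists g; split=> // h /=.
by rewrite inner_trmx (jacobian_left_inverse oX Xp fK df dg) mul_rV_lin1.
Qed.

Lemma transports_comp (R : realType) (n : nat) (X : set 'rV[R]_n)
    (f1 f2 : 'rV[R]_n -> 'rV[R]_n) (a b c : 'rV[R]_n * 'rV[R]_n) :
  X a.1 -> (forall x, X x -> X (f1 x)) ->
  transports X f1 a b -> transports X f2 b c ->
  transports X (f2 \o f1) a c.
Proof.
move=> Xa f1X [b1 [g1 [g1K dg1 bE]]] [c1 [g2 [g2K dg2 cE]]].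
have g2K' : g2 (f2 (f1 a.1)) = f1 a.1 by rewrite g2K // inE; exact: f1X.
rewrite b1 in c1 dg2 cE; split=> //.
have dg1' : differentiable g1 (g2 (f2 (f1 a.1))) by rewrite g2K'.
exists (g1 \o g2); split.
- move=> x; rewrite inE => Xx /=.
  by rewrite g2K ?g1K // inE //; exact: f1X.
- exact: differentiable_comp.
- have dE := diff_comp dg2 dg1'; rewrite g2K' in dE.
  move=> h; rewrite cE bE.
  exact: (congr1 (fun D : 'rV[R]_n -> 'rV[R]_n => inner a.2 (D h)) (esym dE)).
Qed.

Lemma convex_set_segment (R : realType) (n : nat) (A : set 'rV[R]_n)
    (x y : 'rV[R]_n) (t : R) :
  convex_set A -> A x -> A y -> 0 <= t <= 1 -> A (x + t *: (y - x)).
Proof.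
move=> cA Ax Ay /andP[t0 t1].
have := cA y x (Itv01 t0 t1) (mem_set Ay) (mem_set Ax); rewrite inE.
congr A; rewrite /conv /= scalerBl scale1r scalerBr.
by rewrite addrCA.
Qed.

(** The derivative of g at q along h is the limit of difference quotients with
    t > 0, and each of these has a nonpositive inner product with v. *)
Lemma inner_diff_le0 (R : realType) (n : nat) (g : 'rV[R]_n -> 'rV[R]_n)
    (q v h : 'rV[R]_n) :
  differentiable g q ->
  (forall t, 0 < t <= 1 -> inner v (g (q + t *: h) - g q) <= 0) ->
  inner v ('d g q h) <= 0.
Proof.
move=> dg le0; rewrite -deriveE //.
have /cvg_dnbhs_at_right cvgD :
    t^-1 *: ((g \o shift q) (t *: h) - g q) @[t --> 0^'] --> 'D_h g q.
  exact: (diff_derivable dg).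
have cvgI : inner v (t^-1 *: ((g \o shift q) (t *: h) - g q)) @[t --> 0^'+] -->
    inner v ('D_h g q).
  by apply: continuous_cvg cvgD; exact: continuous_inner.
rewrite -(cvg_lim _ cvgI) //; apply: limr_le; first exact: cvgP cvgI.
near=> t; have t0 : 0 < t by near: t; exact: nbhs_right_gt.
rewrite innerZr pmulr_rle0 ?invr_gt0 //= (addrC _ q); apply: le0; rewrite t0 /=.
by near: t; exact: nbhs_right_le.
Unshelve. all: by end_near.
Qed.

(** For z in Omega with f z = q + t (f x - q), the difference g(q + t h) - g(q)
    in the quotient defining g'(q) h, h = f x - q, is just z - p, and this is in
    the half-space that supports Omega at p. *)
Lemma transports_halfspace (R : realType) (n : nat) (X Omega : set 'rV[R]_n)
    (f : 'rV[R]_n -> 'rV[R]_n) (pv qw : 'rV[R]_n * 'rV[R]_n) :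
  Omega `<=` X -> convex_set (f @` Omega) -> Omega pv.1 ->
  (forall x, Omega x -> inner pv.2 (x - pv.1) <= 0) ->
  transports X f pv qw ->
  f @` Omega `<=` halfspace qw.1 qw.2.
Proof.
move=> OX cf Op supp [q1 [g [fK dg wE]]] _ [x Ox <-].
rewrite /halfspace /= q1 wE; apply: inner_diff_le0 => // t /andP[t0 t1].
have [z Oz <-] : (f @` Omega) (f pv.1 + t *: (f x - f pv.1)).
  have t01 : 0 <= t <= 1 by rewrite ltW.
  exact: convex_set_segment cf (imageP f Op) (imageP f Ox) t01.
rewrite (fK z) ?(fK pv.1); first exact: supp.
- by apply: mem_set; exact: OX.
- by apply: mem_set; exact: OX.
Qed.

Lemma psi_stable (R : realType) (n : nat) (U : Type)
    (G : 'rV[R]_n -> U -> 'rV[R]_n) (X : set 'rV[R]_n)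
    (G_stable : forall x w, X x -> X (G x w)) k x w :
  X x -> X (psi G k x w).
Proof. by move=> Xx; elim: k => //= k IH; exact: G_stable. Qed.

(** The time lag tau is kept explicit because it selects the member of the
    intersection that the half-space of the pair qw contains. *)
Definition transported (R : realType) (n : nat) (U : Type)
    (X : set 'rV[R]_n) (G : 'rV[R]_n -> U -> 'rV[R]_n) (u : nat -> U)
    (Sigma : nat -> set ('rV[R]_n * 'rV[R]_n)) (tau k : nat)
    (qw : 'rV[R]_n * 'rV[R]_n) : Prop :=
  exists2 pv, Sigma (k - tau)%N pv &
    transports X (psi G tau ^~ (shift_input (k - tau) u)) pv qw.

Lemma transported_next (R : realType) (n : nat) (U : Type)
    (X W : set 'rV[R]_n) (G : 'rV[R]_n -> U -> 'rV[R]_n) (u : nat -> U)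
    (Sigma : nat -> set ('rV[R]_n * 'rV[R]_n)) (tau k : nat)
    (qw : 'rV[R]_n * 'rV[R]_n)
    (G_stable : forall x w, X x -> X (G x w))
    (G_diffeo : C1_diffeo X W (fun x => G x (u k)))
    (Sigma_X : forall pv, Sigma (k - tau)%N pv -> X pv.1) :
  (tau <= k)%N -> transported X G u Sigma tau k qw ->
  transported X G u Sigma tau.+1 k.+1 (compl_ext (fun x => G x (u k)) qw).
Proof.
move=> tauk [pv Spv T]; exists pv; first by rewrite subSS.
have Xp := Sigma_X _ Spv.
(* The last of the tau + 1 inputs applied from time k - tau on is u k. *)
have -> : psi G tau.+1 ^~ (shift_input (k.+1 - tau.+1) u) =
    (fun x => G x (u k)) \o (psi G tau ^~ (shift_input (k - tau) u)).
  by apply/funext => x /=; rewrite subSS /shift_input subnK.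
apply: (transports_comp Xp _ T) => [x|]; first exact: psi_stable.
by apply: transports_compl_ext G_diffeo _; rewrite T.1; exact: psi_stable.
Qed.

Lemma S_transported (R : realType) (n N : nat) (U : Type)
    (X : set 'rV[R]_n) (G : 'rV[R]_n -> U -> 'rV[R]_n) (u : nat -> U)
    (Sigma S : nat -> set ('rV[R]_n * 'rV[R]_n))
    (G_stable : forall x w, X x -> X (G x w))
    (G_diffeo : forall w, exists W, C1_diffeo X W (fun x => G x w))
    (Sigma_X : forall k pv, (k <= N)%N -> Sigma k pv -> X pv.1)
    (S_0 : S 0%N = Sigma 0%N)
    (S_rec : forall k, (1 <= k <= N)%N ->
        S k = Sigma k `|`
              [set compl_ext (fun x => G x (u k.-1)) pv | pv in S k.-1])
    (k : nat) (qw : 'rV[R]_n * 'rV[R]_n) :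
  (k <= N)%N -> S k qw ->
  exists2 tau, (tau <= k)%N & transported X G u Sigma tau k qw.
Proof.
have lag0 j rz : Sigma j rz -> transported X G u Sigma 0 j rz.
  by move=> Srz; exists rz; [rewrite subn0 | exact: transports_id].
elim: k qw => [|k IH] qw kN.
  by rewrite S_0 => Sqw; exists 0%N => //; exact: lag0.
rewrite S_rec // => -[Sqw|[rz Srz <-]].
  by exists 0%N => //; exact: lag0.
have [tau tauk T] := IH _ (ltnW kN) Srz.
have [W GW] := G_diffeo (u k).
exists tau.+1; first by rewrite ltnS.
have lagN : (k - tau <= N)%N by rewrite (leq_trans (leq_subr _ _)) // ltnW.
exact: (transported_next G_stable GW (fun pv => Sigma_X _ pv lagN) tauk T).
Qed.

Theorem mainTheorem2 (R : realType) (n N : nat) (U : finType)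
    (X : set 'rV[R]_n) (G : 'rV[R]_n -> U -> 'rV[R]_n)
    (C C' : set (set 'rV[R]_n)) (hat : set 'rV[R]_n -> set 'rV[R]_n)
    (Delta : nat -> set 'rV[R]_n) (u : nat -> U)
    (Sigma S : nat -> set ('rV[R]_n * 'rV[R]_n))
    (X_open : open X)
    (G_stable : forall x w, X x -> X (G x w))
    (G_diffeo : forall w, exists W : set 'rV[R]_n,
        [/\ open W, W `<=` X & C1_diffeo X W (fun x => G x w)])
    (C_finite : finite_set C)
    (C_cover : \bigcup_(D in C) D = setT)
    (C_poly : forall D, C D -> D !=set0 /\ convex_polyhedron D)
    (C'_sub : C' `<=` C)
    (hat_sup : forall D, C' D -> D `<=` hat D)
    (hat_X : forall D, C' D -> hat D `<=` X)
    (hat_convex : forall D, C' D ->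
        forall (k : nat) (w : nat -> U), (1 <= k <= N)%N ->
        convex_set [set psi G k x w | x in hat D])
    (Delta_C' : forall k, (k <= N)%N -> C' (Delta k))
    (Sigma_supp : forall k, (k <= N)%N ->
        supporting_convex_approx (hat (Delta k)) (Sigma k))
    (S_0 : S 0%N = Sigma 0%N)
    (S_rec : forall k, (1 <= k <= N)%N ->
        S k = Sigma k `|`
              [set compl_ext (fun x => G x (u k.-1)) pv | pv in S k.-1]) :
  forall k, (1 <= k <= N)%N ->
    outer_convex_approx (reach_cap G (fun j => hat (Delta j)) u k)
      [set compl_ext (fun x => G x (u k.-1)) pv | pv in S k.-1]
    /\
    outer_convex_approx
      (hat (Delta k) `&` reach_cap G (fun j => hat (Delta j)) u k)
      (S k).
Proof.
move=> k kN.
have Sigma_X j pv : (j <= N)%N -> Sigma j pv -> X pv.1.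
  case: pv => p v jN /(Sigma_supp _ jN)[hp _].
  exact: hat_X (Delta_C' _ jN) _ hp.
have G_diff w : exists W, C1_diffeo X W (fun x => G x w).
  by have [W [_ _ ?]] := G_diffeo w; exists W.
have outer : outer_convex_approx (reach_cap G (fun j => hat (Delta j)) u k)
    [set compl_ext (fun x => G x (u k.-1)) pv | pv in S k.-1].
  case: k kN => // k kN x xcap _ [rz Srz <-].
  have [tau tauk T] :=
    S_transported G_stable G_diff Sigma_X S_0 S_rec (ltnW kN) Srz.
  have lagN : (k - tau <= N)%N by rewrite (leq_trans (leq_subr _ _)) // ltnW.
  have [W GW] := G_diff (u k).
  have [[p v] Spv tr] :=
    transported_next G_stable GW (fun pv => Sigma_X _ pv lagN) tauk T.
  rewrite subSS in Spv tr.
  have [Op [_ supp]] := Sigma_supp _ lagN _ _ Spv.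
  have hatX := hat_X _ (Delta_C' _ lagN).
  have convex_image : convex_set
      [set psi G tau.+1 y (shift_input (k - tau) u)
         | y in hat (Delta (k - tau)%N)].
    by apply: hat_convex; [exact: Delta_C' | exact: leq_ltn_trans kN].
  apply: (transports_halfspace (pv := (p, v)) hatX convex_image Op supp tr).
  by rewrite -[(k - tau)%N]subSS; apply: (xcap tau.+1); rewrite /= ltnS.
split=> // x [hx cx]; rewrite S_rec //= => -[p v] [Spv|]; last exact: outer cx _.
have [_ kleN] := andP kN.
by have [_ [_ supp]] := Sigma_supp _ kleN _ _ Spv; exact: supp.
Qed.
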